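(* A complete list of one-dimensional subalgebras of $\mathfrak{sp}(4,\mathbb{C})$ with generators having a nontrivial Jordan decomposition, i.e., that are neither semisimple nor nilpotent, up to conjugacy in $Sp(4,\mathbb{C})$, is $$\langle T_{1,0}+X_{\alpha}\rangle;\qquad \langle T_{1,1}+X_{\beta}\rangle .$$ The subalgebras $\langle T_{a,0}+X_{\alpha}\rangle$ and $\langle T_{0,a}+X_{\alpha+2\beta}\rangle$ are conjugate to $\langle T_{1,0}+X_{\alpha}\rangle$, for any $a\in\mathbb{C}$, $a\neq 0$. The subalgebras $\langle T_{a,a}+X_{\beta}\rangle$ and $\langle T_{a,-a}+X_{\alpha+\beta}\rangle$ are conjugate to $\langle T_{1,1}+X_{\beta}\rangle$, for any $a\in\mathbb{C}$, $a\neq 0$.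
   Context: Let $J=\begin{pmatrix}0&0&1&0\\0&0&0&1\\-1&0&0&0\\0&-1&0&0\end{pmatrix}$. $\mathfrak{sp}(4,\mathbb{C})$ is the Lie algebra of $4\times4$ complex matrices $X$ with $JX^tJ=X$, and $Sp(4,\mathbb{C})=\{g\in GL(4,\mathbb{C}) : gJg^t=J\}$, acting on $\mathfrak{sp}(4,\mathbb{C})$ by conjugation $X\mapsto gXg^{-1}$. Elements are semisimple (nilpotent) if they are so as matrices. For $a,b\in\mathbb{C}$, $T_{a,b}=\mathrm{diag}(a,b,-a,-b)$. With $E_{ij}$ the matrix units, $X_\alpha=E_{24}$, $X_\beta=E_{12}-E_{43}$, $X_{\alpha+\beta}=E_{14}+E_{23}$, $X_{\alpha+2\beta}=E_{13}$. $\langle\,\cdot\,\rangle$ denotes the complex linear span. Two subalgebras are conjugate if some $g\in Sp(4,\mathbb{C})$ conjugates one onto the other. *)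

(* Defs.v *)
From HB Require Import structures.
From mathcomp Require Import all_boot all_order all_algebra.
From mathcomp Require Import complex reals.

Set Implicit Arguments.
Unset Strict Implicit.
Unset Printing Implicit Defensive.

Import GRing.Theory.
Local Open Scope ring_scope.

Section Sp4.
Variable F : fieldType.
Implicit Types (X Y g : 'M[F]_4) (L M : {vspace 'M[F]_4}).

Definition sp4_J : 'M[F]_4 :=
  block_mx 0 1%:M (- 1%:M) 0 : 'M[F]_(2 + 2).

Definition in_sp4 X : Prop := sp4_J *m X^T *m sp4_J = X.

Definition in_Sp4 g : Prop := g \in unitmx /\ g *m sp4_J *m g^T = sp4_J.

Definition lie_bracket X Y : 'M[F]_4 := X *m Y - Y *m X.

Definition sp4_subalgebra L : Prop :=
  (forall X, X \in L -> in_sp4 X) /\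
  (forall X Y, X \in L -> Y \in L -> lie_bracket X Y \in L).

(* The adjoint action of g, as a linear endomorphism of the space of matrices;
   linfun is meaningful here because mulmx g and mulmxr (invmx g) are linear. *)
Definition sp4_Ad g : 'End('M[F]_4) := linfun (mulmxr (invmx g) \o mulmx g).

Lemma sp4_AdE g X : sp4_Ad g X = g *m X *m invmx g.
Proof. by rewrite lfunE. Qed.

Definition Sp4_conjugate L M : Prop :=
  exists2 g, in_Sp4 g & (sp4_Ad g @: L)%VS = M.

(* Semisimplicity of a matrix is diagonalizability; this is the usual notion
   only when F is algebraically closed. *)
Definition mx_semisimple X : Prop := diagonalizable X.

Definition mx_nilpotent X : Prop := exists k : nat, X ^+ k = 0.

(* On a one-dimensional L the generators are exactly the nonzero elements. *)
Definition mixed_line_subalgebra L : Prop :=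
  [/\ sp4_subalgebra L, \dim L = 1%N &
      forall X, L = <[X]>%VS -> ~ mx_semisimple X /\ ~ mx_nilpotent X].

(* Matrix units with the 1-based indices 1, ..., 4. *)
Definition sp4_E (i j : nat) : 'M[F]_4 := delta_mx (inord i.-1) (inord j.-1).

Definition sp4_T (a b : F) : 'M[F]_4 :=
  diag_mx (\row_(i < 4) [:: a; b; - a; - b]`_i).

Definition X_alpha : 'M[F]_4 := sp4_E 2 4.
Definition X_beta : 'M[F]_4 := sp4_E 1 2 - sp4_E 4 3.
Definition X_alpha_beta : 'M[F]_4 := sp4_E 1 4 + sp4_E 2 3.
Definition X_alpha_2beta : 'M[F]_4 := sp4_E 1 3.

End Sp4.

Arguments X_alpha {F}.
Arguments X_beta {F}.
Arguments X_alpha_beta {F}.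
Arguments X_alpha_2beta {F}.

(* Main.v *)
(** Write [sform u v = u J v^T] for row vectors; in_sp4 says that X is skew for
    this symplectic form, so the adjoint of q(X) is q(-X).  The characteristic
    polynomial of X is therefore even and X is annihilated by
    (x^2 - l^2)(x^2 - m^2).  If l^2 and m^2 are distinct and nonzero, X is
    semisimple; if l = m = 0, it is nilpotent.  If l <> 0 = m, cutting vectors
    out of the generalized eigenspaces for l, -l and 0 gives a symplectic basis
    in which X is l (T_{1,0} + X_alpha); if l^2 = m^2 <> 0, the generalized
    eigenspaces for l and -l give one in which X is l (T_{1,1} + X_beta).  That
    the vectors pair nontrivially is read off the nonvanishing of a suitable
    q(X): if q(X) = 0, then also q(-X) = 0, and combining the two would make X
    nilpotent or semisimple.  The two lines are not conjugate because
    T_{1,0} + X_alpha is singular and T_{1,1} + X_beta is invertible. *)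
Require Import Defs.
From mathcomp Require Import all_boot all_order all_algebra.
From mathcomp Require Import complex reals ring.

Set Implicit Arguments.
Unset Strict Implicit.
Unset Printing Implicit Defensive.

Import GRing.Theory Num.Theory.
Local Open Scope ring_scope.

(** * The symplectic form and its adjunction rule *)

Section Sp4Lines.
Variable F : fieldType.
Implicit Types (X : 'M[F]_4) (u v w : 'rV[F]_4) (q : {poly F}).
Local Notation J := (sp4_J F).

(** Vectors are rows and matrices act on the right, so [sp4_E i j] sends the i-th basis vector to
    the j-th, and the Gram matrix of the rows of g is g J g^T, as in [in_Sp4]. *)
Definition sform u v : F := (u *m J *m v^T) 0 0.

Lemma sp4_J_sqr : J *m J = - 1%:M.
Proof.
rewrite -[LHS]/((sp4_J F : 'M_(2 + 2)) *m (sp4_J F : 'M_(2 + 2))) /sp4_J.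
rewrite (mulmx_block (0 : 'M[F]_2)) !mul0mx !mulmx0 !mul1mx !mulmx1 !add0r !addr0.
by rewrite -[RHS]/(- (1%:M : 'M_(2+2))) scalar_mx_block opp_block_mx !oppr0.
Qed.

Lemma tr_sp4_J : J^T = - J.
Proof.
rewrite -[LHS]/((sp4_J F : 'M_(2 + 2))^T) -[RHS]/(- (sp4_J F : 'M_(2 + 2))).
by rewrite /sp4_J tr_block_mx opp_block_mx !linearN /= !trmx0 !trmx1 !oppr0 opprK.
Qed.

Lemma in_sp4_mulJ X : in_sp4 X -> X *m J = - (J *m X^T).
Proof. by move=> XE; rewrite -{1}XE -mulmxA sp4_J_sqr mulmxN mulmx1. Qed.

Lemma in_sp4_horner X q : in_sp4 X ->
  horner_mx X q *m J = J *m (horner_mx X (q \Po - 'X))^T.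
Proof.
move=> /in_sp4_mulJ XJ; elim/poly_ind: q => [|q c IH].
  by rewrite comp_poly0 !rmorph0 mul0mx trmx0 mulmx0.
rewrite comp_polyD comp_polyM comp_polyX comp_polyC [(_ \Po _) * _]mulrC.
rewrite !rmorphD !rmorphM /= rmorphN /=.
rewrite !horner_mx_C !horner_mx_X linearD /= tr_scalar_mx trmx_mul linearN /=.
rewrite mulmxDl mulmxDr scalar_mxC; congr (_ + _).
by rewrite -[_ * X]/(_ *m X) -mulmxA XJ mulmxN mulmxA IH !mulmxN !mulmxA.
Qed.

Lemma sform_addl u v w : sform (u + v) w = sform u w + sform v w.
Proof. by rewrite /sform !mulmxDl mxE. Qed.

Lemma sform_addr u v w : sform w (u + v) = sform w u + sform w v.
Proof. by rewrite /sform linearD mulmxDr mxE. Qed.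

Lemma sform_scalel a u v : sform (a *: u) v = a * sform u v.
Proof. by rewrite /sform -!scalemxAl mxE. Qed.

Lemma sform_scaler a u v : sform u (a *: v) = a * sform u v.
Proof. by rewrite /sform linearZ -!scalemxAr mxE. Qed.

Lemma sform_oppr u v : sform u (- v) = - sform u v.
Proof. by rewrite -scaleN1r sform_scaler mulN1r. Qed.

Lemma sform_oppl u v : sform (- u) v = - sform u v.
Proof. by rewrite -scaleN1r sform_scalel mulN1r. Qed.

Lemma sform0r u : sform u 0 = 0.
Proof. by rewrite -[0](scale0r 0) sform_scaler mul0r. Qed.

Lemma sformC u v : sform u v = - sform v u.
Proof.
rewrite /sform -[LHS]trace_mx11 -mxtrace_tr !trmx_mul trmxK tr_sp4_J trace_mx11.
by rewrite mulNmx mulmxN mulmxA mxE.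
Qed.

Lemma sformxx u : 2%:R != 0 :> F -> sform u u = 0.
Proof.
move=> F2; have /eqP := sformC u u.
by rewrite -addr_eq0 -mulr2n -mulr_natl mulf_eq0 (negPf F2) => /eqP.
Qed.

Lemma sform_sp4 X u v : in_sp4 X -> sform (u *m X) v = - sform u (v *m X).
Proof.
move=> /in_sp4_mulJ XJ; rewrite /sform -(mulmxA u) XJ trmx_mul mulmxN mulNmx mxE.
by rewrite !mulmxA.
Qed.

Lemma sform_neq0 (A : 'M_4) : A != 0 -> exists u v, sform (u *m A) v != 0.
Proof.
(* J is invertible, so A J has a nonzero entry, and a pair of standard basis vectors reads that
   entry off. *)
move=> A0; have /matrix0Pn[i [j AJ]] : A *m J != 0.
  apply: contraNneq A0 => AJ.
  by rewrite -[A]opprK -[A]mulmx1 -mulmxN -sp4_J_sqr mulmxA AJ mul0mx oppr0.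
exists (delta_mx 0 i), (delta_mx 0 j).
by rewrite /sform trmx_delta -[_ *m A *m _]mulmxA -rowE -colE 2!mxE.
Qed.

(** * Symplectic frames and conjugacy of lines *)

Lemma in_Sp4_rows (r : 'I_4 -> 'rV[F]_4) :
  (forall i j, sform (r i) (r j) = J i j) -> in_Sp4 (\matrix_i r i).
Proof.
move=> rJ; set g := \matrix_i r i.
have gJ : g *m J *m g^T = J.
  apply/matrixP => i j; rewrite -rJ /sform -[in RHS](rowK r i) -[in RHS](rowK r j).
  by rewrite -row_mul tr_row !mxE; apply: eq_bigr => k _; rewrite !mxE.
(* Invertibility is automatic: J^2 = -1 makes - J g^T J a right inverse of g. *)
split=> //; suff /mulmx1_unit[]: g *m (- (J *m g^T *m J)) = 1%:M by [].
by rewrite mulmxN !mulmxA gJ sp4_J_sqr opprK.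
Qed.

(** A diagonalizable matrix has no Jordan chain of length two: in an eigenbasis A - c is diagonal,
    and d_i^2 w_i = 0 forces d_i w_i = 0. *)
Lemma diagonalizable_ker2 n (A : 'M[F]_n) c (u : 'rV_n) : diagonalizable A ->
  u *m (A - c%:M) *m (A - c%:M) = 0 -> u *m (A - c%:M) = 0.
Proof.
move=> [P Pu /(mxred.similar_diagLR Pu)[d AE]].
have -> : A - c%:M = invmx P *m (diag_mx d - c%:M) *m P.
  rewrite AE mxred.conjVmx // mulmxBr mulmxBl scalar_mxC.
  by rewrite -(mulmxA _ (invmx P)) mulVmx // mulmx1.
have -> : diag_mx d - c%:M = diag_mx (d - const_mx c).
  by rewrite linearB /= diag_const_mx.
set D := diag_mx _; rewrite !mulmxA mulmxK // => /(congr1 (mulmx^~ (invmx P))).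
rewrite mul0mx -!mulmxA mulmxV // mulmx1 !mulmxA => uDD.
suff -> : u *m invmx P *m D = 0 by rewrite mul0mx.
move: uDD; set w := u *m _ => wDD.
apply/rowP=> i; move/rowP/(_ i): wDD; rewrite !mul_mx_diag !mxE => /eqP.
by rewrite mulf_eq0 => /orP[/eqP//|/eqP->]; rewrite mulr0.
Qed.

(** A line forgets the scale of its generator, so g X g^-1 need only be a nonzero multiple of N. *)
Lemma Sp4_conjugate_line X N (a : F) g :
    in_Sp4 g -> a != 0 -> g *m X = a *: (N *m g) ->
  Sp4_conjugate <[X]> <[N]>.
Proof.
move=> Sg a0 gX; exists g => //; rewrite limg_line sp4_AdE gX.
rewrite -scalemxAl mulmxK; last by case: Sg.
apply/eqP; rewrite eqEsubv -!memvE; apply/andP; split; first exact/memvZ/memv_line.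
by apply/vlineP; exists a^-1; rewrite scalerA mulVf ?scale1r.
Qed.

Lemma sp4_JE (i j : 'I_4) :
  J i j = (j == i.+2 :> nat)%:R - (i == j.+2 :> nat)%:R.
Proof.
rewrite !mxE; case: splitP => i' ->; rewrite !mxE; case: splitP => j' ->; rewrite !mxE.
all: by move: i' j' => [[|[|i']] //= ?] [[|[|j']] //= ?];
  rewrite ?subrr ?subr0 ?sub0r ?oppr0.
Qed.

(* Standard basis indexed from 1, as in sp4_E; bvec 0 is a duplicate of bvec 1. *)
Definition bvec (i : nat) : 'rV[F]_4 := delta_mx 0 (inord i.-1).

Lemma bvec_neq0 i : bvec i != 0.
Proof.
apply/eqP => /rowP/(_ (inord i.-1)); rewrite !mxE !eqxx => /eqP.
by rewrite oner_eq0.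
Qed.

Lemma sform_bvec i j : (0 < i <= 4)%N -> (0 < j <= 4)%N ->
  sform (bvec i) (bvec j) = (j == i.+2)%:R - (i == j.+2)%:R.
Proof.
move=> i4 j4; rewrite /sform trmx_delta -rowE -colE 2!mxE sp4_JE.
by move: i j i4 j4 => [|[|[|[|[|i]]]]] //= [|[|[|[|[|j]]]]] //= _ _; rewrite !inordK.
Qed.

Lemma bvec_sp4_E i j k : (0 < i <= 4)%N -> (0 < j <= 4)%N ->
  bvec i *m sp4_E F j k = (i == j)%:R *: bvec k.
Proof.
move=> i4 j4; rewrite mul_delta_mx_cond scaler_nat -(inj_eq val_inj) /=.
by move: i j i4 j4 => [|[|[|[|[|i]]]]] //= [|[|[|[|[|j]]]]] //= _ _; rewrite !inordK.
Qed.

Lemma bvec_sp4_T i a b : (0 < i <= 4)%N ->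
  bvec i *m sp4_T a b = [:: a; b; - a; - b]`_i.-1 *: bvec i.
Proof.
move=> i4; apply/rowP => j; rewrite -rowE !mxE eqxx /=.
rewrite eq_sym; case: (j =P _) => [_|_]; last by rewrite mulr0n mulr0.
by rewrite mulr1n mulr1 inordK //; case: i i4.
Qed.

Lemma sp4_frame_mul (r1 r2 r3 r4 : 'rV[F]_4)
  (g := \matrix_(i < 4) [:: r1; r2; r3; r4]`_i) :
  [/\ bvec 1 *m g = r1, bvec 2 *m g = r2, bvec 3 *m g = r3 & bvec 4 *m g = r4].
Proof. by split; rewrite -rowE rowK inordK. Qed.

(** The rows form a symplectic basis in which X has matrix a N. Six pairings determine the Gram
    matrix because the form is alternating. *)
Lemma Sp4_conjugate_frame X N (a : F) (r1 r2 r3 r4 : 'rV[F]_4)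
    (g := \matrix_(i < 4) [:: r1; r2; r3; r4]`_i) : 2%:R != 0 :> F -> a != 0 ->
    sform r1 r2 = 0 -> sform r1 r3 = 1 -> sform r1 r4 = 0 ->
    sform r2 r3 = 0 -> sform r2 r4 = 1 -> sform r3 r4 = 0 ->
    (forall i, (0 < i <= 4)%N ->
       [:: r1; r2; r3; r4]`_i.-1 *m X = a *: (bvec i *m N *m g)) ->
  Sp4_conjugate <[X]> <[N]>.
Proof.
move=> F2 a0 r12 r13 r14 r23 r24 r34 rX.
have Sg : in_Sp4 g.
  apply: in_Sp4_rows => i j; rewrite sp4_JE.
  move: i j => [[|[|[|[|i]]]] //= ?] [[|[|[|[|j]]]] //= ?];
    rewrite ?subr0 ?sub0r //;
    first [ by [] | by rewrite sformC ?r12 ?r13 ?r14 ?r23 ?r24 ?r34 ?oppr0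
          | exact: sformxx ].
apply: Sp4_conjugate_line Sg a0 _; apply/row_matrixP => i.
rewrite linearZ /= 2!row_mul rowK [row i N]rowE.
by have /= -> := rX i.+1 (ltn_ord i); rewrite /bvec /= inord_val.
Qed.

(** * Normal forms from generalized eigenvectors *)

Lemma sform_eigen_ker (X : 'M[F]_4) (a : F) u v : in_sp4 X -> a != 0 ->
  u *m X = a *: u -> v *m X *m X = 0 -> sform u v = 0 /\ sform u (v *m X) = 0.
Proof.
move=> Xsp a0 uX vXX.
have uvX z : a * sform u z = - sform u (z *m X).
  by rewrite -sform_scalel -uX sform_sp4.
(* Skewness is used first at z = v X, where z X = 0, and then at z = v. *)
have uvX0 : sform u (v *m X) = 0.
  by have /eqP := uvX (v *m X); rewrite vXX sform0r oppr0 mulf_eq0 (negPf a0) => /eqP.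
by split=> //; have /eqP := uvX v; rewrite uvX0 oppr0 mulf_eq0 (negPf a0) => /eqP.
Qed.

(** The spans of u, w and of v, v X are orthogonal by [sform_eigen_ker]; each pair is scaled so as
    to pair to 1. *)
Lemma Sp4_conjugate_T10 (X : 'M[F]_4) (a : F) u v w :
    2%:R != 0 :> F -> (forall x : F, exists t, t ^+ 2 = x) -> in_sp4 X -> a != 0 ->
    u *m X = a *: u -> w *m X = - a *: w -> v *m X *m X = 0 ->
    sform u w != 0 -> sform v (v *m X) != 0 ->
  Sp4_conjugate <[X]> <[sp4_T 1 0 + X_alpha]>.
Proof.
(* The vectors t v and (t / a) v X must pair to 1, which prescribes t^2. Scaling v also scales v X,
   hence the square root. *)
move=> F2 sqF Xsp a0 uX wX vXX uw vvX; have [t t2] := sqF (a / sform v (v *m X)).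
have [uv uvX] := sform_eigen_ker Xsp a0 uX vXX.
have na0 : - a != 0 by rewrite oppr_eq0.
have [wv wvX] := sform_eigen_ker Xsp na0 wX vXX.
apply: (@Sp4_conjugate_frame _ _ a u (t *: v) ((sform u w)^-1 *: w)
          ((a^-1 * t) *: (v *m X))) => //.
- by rewrite sform_scaler uv mulr0.
- by rewrite sform_scaler mulVf.
- by rewrite sform_scaler uvX mulr0.
- by rewrite sform_scalel sform_scaler (sformC v) wv oppr0 !mulr0.
- rewrite sform_scalel sform_scaler mulrA [t * _]mulrCA -expr2 t2.
  by field; rewrite ?a0 ?vvX ?uw.
- by rewrite sform_scaler sform_scalel wvX !mulr0.
have [e1 e2 e3 e4] := sp4_frame_mul u (t *: v) ((sform u w)^-1 *: w)
  ((a^-1 * t) *: (v *m X)).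
case=> [|[|[|[|[|i]]]]] // _; rewrite mulmxDr bvec_sp4_T // bvec_sp4_E //=
  mulmxDl -!scalemxAl ?e1 ?e2 ?e3 ?e4 ?scale0r ?scale1r ?addr0 ?add0r //.
- by rewrite scalerA mulrA divff ?mul1r.
- by rewrite wX !scalerA; congr (_ *: _); ring.
- by rewrite vXX oppr0 scale0r !scaler0.
Qed.

(** The chains u, u' and w, w' span isotropic subspaces, paired with each other by the form. Since u
    and w can be scaled independently, no square root enters. *)
Lemma Sp4_conjugate_T11 (X : 'M[F]_4) (a : F) u w :
    2%:R != 0 :> F -> in_sp4 X -> a != 0 ->
    u *m (X - a%:M) *m (X - a%:M) = 0 -> w *m (X + a%:M) *m (X + a%:M) = 0 ->
    sform (u *m (X - a%:M)) w != 0 ->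
  Sp4_conjugate <[X]> <[sp4_T 1 1 + X_beta]>.
Proof.
move=> F2 Xsp a0; set u' := u *m (X - _); set w' := w *m (X + _) => uX wX uw.
have uE : u *m X = a *: u + u' by rewrite /u' mulmxBr mul_mx_scalar addrC subrK.
have wE : w *m X = - a *: w + w'.
  by rewrite /w' mulmxDr mul_mx_scalar scaleNr addrC addrK.
have u'E : u' *m X = a *: u'.
  by apply/eqP; rewrite -subr_eq0 -mul_mx_scalar -mulmxBr uX.
have w'E : w' *m X = - a *: w'.
  by apply/eqP; rewrite scaleNr -addr_eq0 -mul_mx_scalar -mulmxDr wX.
have a2 : a + a != 0 by rewrite -mulr2n -mulr_natl mulf_neq0.
(* Skewness of X on the pairs (u, u'), (w, w'), (u', w) and (u, w) yields the next four relations in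
   turn. *)
have uu' : sform u u' = 0.
  have := sform_sp4 u u' Xsp; rewrite uE u'E sform_addl sform_scalel sform_scaler.
  rewrite sformxx // addr0 => /eqP; rewrite -addr_eq0 -mulrDl mulf_eq0 (negPf a2).
  by move/eqP.
have ww' : sform w w' = 0.
  have := sform_sp4 w w' Xsp; rewrite wE w'E sform_addl sform_scalel sform_scaler.
  rewrite sformxx // addr0 => /eqP; rewrite -addr_eq0 -mulrDl mulf_eq0 -opprD oppr_eq0.
  by rewrite (negPf a2) => /eqP.
have u'w' : sform u' w' = 0.
  have := sform_sp4 u' w Xsp; rewrite wE u'E sform_addr sform_scalel sform_scaler.
  by rewrite opprD mulNr opprK -{1}[a * _]addr0 => /addrI/eqP;
    rewrite eq_sym oppr_eq0 => /eqP.
have uw' : sform u w' = - sform u' w.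
  have := sform_sp4 u w Xsp; rewrite wE uE sform_addr sform_addl.
  rewrite sform_scalel sform_scaler.
  by rewrite opprD mulNr opprK => /addrI ->; rewrite opprK.
(* The correction s w' makes [r4] orthogonal to u, and c normalizes the pairings of u with [r3] and
   of [r2] with [r4]. The sign of [r3] matches the entry - E_43 of [X_beta]. *)
pose c := a / sform u' w; pose s := sform u w / sform u' w.
pose r2 := a^-1 *: u'; pose r3 := - (c / a) *: w'; pose r4 := c *: (w + s *: w').
have c0 : c != 0 by rewrite mulf_neq0 ?invr_eq0.
apply: (@Sp4_conjugate_frame _ _ a u r2 r3 r4) => //.
- by rewrite sform_scaler uu' mulr0.
- by rewrite sform_scaler uw' /c; field; rewrite ?a0 ?uw.
- by rewrite sform_scaler sform_addr sform_scaler uw' /c /s; field.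
- by rewrite sform_scaler sform_scalel u'w' !mulr0.
- rewrite sform_scaler sform_scalel sform_addr sform_scaler u'w' /c.
  by field; rewrite ?a0 ?vvX ?uw.
- rewrite sform_scaler sform_scalel sform_addr sform_scaler (sformC w') ww' sformxx //.
  by rewrite oppr0 mulr0 addr0 !mulr0.
have [e1 e2 e3 e4] := sp4_frame_mul u r2 r3 r4.
case=> [|[|[|[|[|i]]]]] // _; rewrite mulmxDr mulmxBr bvec_sp4_T // !bvec_sp4_E //=
  !mulmxDl mulNmx -!scalemxAl ?e1 ?e2 ?e3 ?e4 ?scale0r ?scale1r ?subr0 ?addr0 ?add0r //.
- by rewrite uE /r2 scalerDr scalerA divff ?scale1r.
- by rewrite u'E !scalerA mulrC.
- by rewrite w'E !scalerA; congr (_ *: _); ring.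
- rewrite mulmxDl -scalemxAl wE w'E /r4 /r3 !(scalerDr, scalerN, scalerA, scalerBr).
  by rewrite -scaleNr -!addrA -!scalerDl; congr (_ *: _ + _ *: _); field.
Qed.

(** * Polynomials in X and the form *)

Lemma horner_mx_comp_oppX_eq0 (X : 'M[F]_4) q : in_sp4 X ->
  horner_mx X q = 0 -> horner_mx X (q \Po - 'X) = 0.
Proof.
move=> Xsp qX; have := in_sp4_horner q Xsp; rewrite qX mul0mx => /esym qX'.
apply: trmx_inj; rewrite trmx0 -[LHS]opprK -[_^T]mul1mx -mulNmx -sp4_J_sqr.
by rewrite -mulmxA qX' mulmx0 oppr0.
Qed.

Lemma sform_horner (X : 'M[F]_4) q u v : in_sp4 X ->
  sform u (v *m horner_mx X q) = sform (u *m horner_mx X (q \Po - 'X)) v.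
Proof.
(* The matrix rule is applied to q(-x), since substituting -x twice gives back q. *)
move=> Xsp; have /= := in_sp4_horner (q \Po - 'X) Xsp.
rewrite -comp_polyA rmorphN /= comp_polyX opprK comp_polyXr => qJ.
by rewrite /sform trmx_mul mulmxA -(mulmxA u J) -qJ mulmxA.
Qed.

Lemma mulmx_horner_mx (X : 'M[F]_4) p q u :
  u *m horner_mx X p *m horner_mx X q = u *m horner_mx X (p * q).
Proof. by rewrite -mulmxA rmorphM. Qed.

Lemma mulmx_horner_mxX (X : 'M[F]_4) q u :
  u *m horner_mx X q *m X = u *m horner_mx X (q * 'X).
Proof. by rewrite -mulmx_horner_mx horner_mx_X. Qed.

Lemma horner_mx_XsubC (X : 'M[F]_4) (a : F) :
  horner_mx X ('X - a%:P) = X - a%:M.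
Proof. by rewrite rmorphB /= horner_mx_X horner_mx_C. Qed.

Lemma horner_mx_eigen (X : 'M[F]_4) q (a : F) u : horner_mx X (q * ('X - a%:P)) = 0 ->
  u *m horner_mx X q *m X = a *: (u *m horner_mx X q).
Proof.
move=> qX; apply/eqP; rewrite -subr_eq0 -mul_mx_scalar -mulmxBr.
by rewrite -horner_mx_XsubC mulmx_horner_mx qX mulmx0.
Qed.

(* Polarization: the hypothesis says that u, v |-> sform u (v Y) is symmetric. *)
Lemma sform_quad_neq0 (Y : 'M[F]_4) : 2%:R != 0 :> F ->
    (forall u v, sform u (v *m Y) = sform v (u *m Y)) -> Y != 0 ->
  exists v, sform v (v *m Y) != 0.
Proof.
move=> F2 symY /sform_neq0[u [v]]; rewrite sformC oppr_eq0 => vuY.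
have [vv|] := eqVneq (sform v (v *m Y)) 0; last by exists v.
have [uu|] := eqVneq (sform u (u *m Y)) 0; last by exists u.
exists (v + u); rewrite mulmxDl sform_addl !sform_addr vv uu add0r addr0.
by rewrite (symY u) -mulr2n -mulr_natl mulf_neq0.
Qed.

Lemma diagonalizable_roots (X : 'M[F]_4) (rs : seq F) : uniq rs ->
  horner_mx X (\prod_(r <- rs) ('X - r%:P)) = 0 -> mx_semisimple X.
Proof.
by move=> rs_uniq /mxminpoly_min rsX; apply/diagonalizableP; exists rs.
Qed.

Definition comp_polyE :=
  (comp_polyM, comp_polyB, comp_polyD, comp_polyX, comp_polyC, rmorphXn).

(** * Normal forms from an annihilating polynomial *)

Lemma Sp4_conjugate_T10_poly (X : 'M[F]_4) (l : F) :
    2%:R != 0 :> F -> (forall x : F, exists t, t ^+ 2 = x) -> in_sp4 X -> l != 0 ->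
    horner_mx X (('X^2 - l%:P ^+ 2) * 'X^2) = 0 ->
    ~ mx_semisimple X -> ~ mx_nilpotent X ->
  Sp4_conjugate <[X]> <[sp4_T 1 0 + X_alpha]>.
Proof.
move=> F2 sqF Xsp l0 pX nss nnil; set L := l%:P in pX.
have p0 q : horner_mx X (('X^2 - L ^+ 2) * 'X^2 * q) = 0 by rewrite rmorphM /= pX mul0r.
have l2 : l != - l by rewrite -addr_eq0 -mulr2n -mulr_natl mulf_neq0.
(* Otherwise X would be annihilated by a polynomial with the distinct roots 0, l, -l. *)
have sX : horner_mx X ('X * ('X^2 - L ^+ 2)) != 0.
  apply/eqP => sX; apply: nss; apply: (@diagonalizable_roots _ [:: 0; l; - l]).
    by rewrite /= !inE negb_or ![0 == _]eq_sym oppr_eq0 l0 l2.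
  rewrite unlock /= !polyCN polyC0 -/L -[RHS]sX; congr horner_mx.
  by ring.
(* Up to sign this is the pairing of the eigenvectors u' (X + l) X^2 and w' (X - l) X^2 chosen
   below. If q(X) = 0, then q(X) - q(-X) = 4 l X^5 vanishes and X is nilpotent. *)
have [u' [w' uw]] : exists u w,
    sform (u *m horner_mx X (('X + L) ^+ 2 * 'X^4)) w != 0.
  apply: sform_neq0; apply/eqP => qX.
  have := horner_mx_comp_oppX_eq0 Xsp qX => q'X; apply: nnil; exists 5%N.
  move: (congr2 (fun a b => a - b) qX q'X).
  rewrite -rmorphB subrr !comp_polyE /=.
  have -> : ('X + L) ^+ 2 * 'X^4 - (- 'X + L) ^+ 2 * (- 'X) ^+ 4 =
      4%:R * L * 'X ^+ 5 by ring.
  rewrite -(rmorph_nat polyC) -polyCM rmorphM rmorphXn /= horner_mx_X horner_mx_C.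
  rewrite -[_ * _]/(_ *m _) mul_scalar_mx => /eqP.
  rewrite scaler_eq0 (natrM _ 2 2) !mulf_eq0.
  by rewrite (negPf F2) (negPf l0) => /eqP.
(* This is the pairing of v (X^2 - l^2) with its image under X. The polynomial is odd, so the
   bilinear form is symmetric; modulo the annihilator it equals - l^2 x (x^2 - l^2), nonzero at X by
   [sX]. *)
have [v vX] : exists v, sform v (v *m horner_mx X ('X * ('X^2 - L ^+ 2) ^+ 2)) != 0.
  apply: sform_quad_neq0 => // [u v|].
    rewrite sform_horner // sformC !comp_polyE.
    have -> : - 'X * ((- 'X) ^+ 2 - L ^+ 2) ^+ 2 =
        - ('X * ('X ^+ 2 - L ^+ 2) ^+ 2) :> {poly F} by ring.
    by rewrite rmorphN mulmxN sform_oppr opprK.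
  have -> : 'X * ('X^2 - L ^+ 2) ^+ 2 =
      ('X^2 - L ^+ 2) * 'X^2 * 'X - L ^+ 2 * ('X * ('X^2 - L ^+ 2)) by ring.
  rewrite rmorphB /= p0 sub0r oppr_eq0 rmorphM rmorphXn /= horner_mx_C.
  rewrite -rmorphXn -[_ * _]/(_ *m _) mul_scalar_mx.
  by rewrite scaler_eq0 negb_or expf_neq0.
(* Each vector is multiplied by the cofactor of x - l, x^2 or x + l in the annihilator, which moves
   it into the required kernel. *)
apply: (@Sp4_conjugate_T10 _ l (u' *m horner_mx X (('X + L) * 'X^2))
          (v *m horner_mx X ('X^2 - L ^+ 2)) (w' *m horner_mx X (('X - L) * 'X^2))) => //.
- by apply: horner_mx_eigen; rewrite -[RHS](p0 1); congr horner_mx; rewrite -/L; ring.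
- apply: horner_mx_eigen; rewrite polyCN -[RHS](p0 1); congr horner_mx.
  by rewrite -/L; ring.
- by rewrite !mulmx_horner_mxX -mulrA -expr2 pX mulmx0.
- rewrite sform_horner // mulmx_horner_mx !comp_polyE.
  have -> : ('X + L) * 'X^2 * ((- 'X - L) * (- 'X) ^+ 2) =
      - (('X + L) ^+ 2 * 'X^4) by ring.
  by rewrite rmorphN mulmxN sform_oppl oppr_eq0.
rewrite mulmx_horner_mxX sformC sform_horner // mulmx_horner_mx !comp_polyE sformC opprK.
rewrite [X in horner_mx _ X](_ : _ = 'X * ('X^2 - L ^+ 2) ^+ 2) //.
by ring.
Qed.

Lemma Sp4_conjugate_T11_poly (X : 'M[F]_4) (l : F) :
    2%:R != 0 :> F -> in_sp4 X -> l != 0 ->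
    horner_mx X (('X^2 - l%:P ^+ 2) ^+ 2) = 0 -> ~ mx_semisimple X ->
  Sp4_conjugate <[X]> <[sp4_T 1 1 + X_beta]>.
Proof.
move=> F2 Xsp l0 pX nss; set L := l%:P in pX.
have p0 q : horner_mx X (('X^2 - L ^+ 2) ^+ 2 * q) = 0 by rewrite rmorphM /= pX mul0r.
have l2 : l != - l by rewrite -addr_eq0 -mulr2n -mulr_natl mulf_neq0.
(* This is the pairing of u' (X + l)^2 (X - l) with w' (X - l)^2. If q(X) = 0, then q(X) + q(-X)
   reduces modulo the annihilator to 8 l^3 (X^2 - l^2), so X is semisimple. *)
have [u' [w' uw]] : exists u w,
    sform (u *m horner_mx X (('X + L) ^+ 4 * ('X - L))) w != 0.
  apply: sform_neq0; apply/eqP => qX.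
  have := horner_mx_comp_oppX_eq0 Xsp qX => q'X; apply: nss.
  apply: (@diagonalizable_roots _ [:: l; - l]); first by rewrite /= inE l2.
  rewrite unlock /= mulr1 polyCN -/L opprK.
  move: (congr2 (fun a b => a + b) qX q'X).
  rewrite -rmorphD addr0 !comp_polyE /=.
  have -> : ('X + L) ^+ 4 * ('X - L) + (- 'X + L) ^+ 4 * (- 'X - L) =
      ('X^2 - L ^+ 2) ^+ 2 * (6%:R * L) + (2%:R ^+ 3 * L ^+ 3) * (('X - L) * ('X + L)).
    by ring.
  rewrite rmorphD /= p0 add0r -(rmorph_nat polyC) -exprMn -polyCM -polyC_exp.
  rewrite rmorphM /= horner_mx_C.
  rewrite -[_ * _]/(_ *m _) mul_scalar_mx => /eqP; rewrite scaler_eq0 expf_eq0 mulf_eq0.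
  by rewrite (negPf F2) (negPf l0) => /eqP.
have XD : X + l%:M = X - (- l)%:M by rewrite raddfN opprK.
apply: (@Sp4_conjugate_T11 _ l (u' *m horner_mx X (('X + L) ^+ 2))
         (w' *m horner_mx X (('X - L) ^+ 2))) => //;
  rewrite ?XD -!horner_mx_XsubC !mulmx_horner_mx ?polyCN -/L ?opprK.
- rewrite [X in horner_mx _ X](_ : _ = ('X^2 - L ^+ 2) ^+ 2) ?pX ?mulmx0 //; ring.
- rewrite [X in horner_mx _ X](_ : _ = ('X^2 - L ^+ 2) ^+ 2) ?pX ?mulmx0 //; ring.
rewrite sform_horner // mulmx_horner_mx !comp_polyE.
by rewrite [X in horner_mx _ X](_ : _ = ('X + L) ^+ 4 * ('X - L)) //; ring.
Qed.

(** * The characteristic polynomial and completeness *)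

Lemma char_poly_sp4_even (X : 'M[F]_4) : in_sp4 X ->
  char_poly X \Po - 'X = char_poly X.
Proof.
move=> Xsp; pose Jp := map_mx polyC J.
have JpX : Jp *m map_mx polyC X^T *m Jp = map_mx polyC X by rewrite -!map_mxM Xsp.
have Jp2 : Jp *m Jp = - 1%:M by rewrite -map_mxM sp4_J_sqr map_mxN map_mx1.
rewrite /char_poly -det_map_mx.
(* Since J J = -1 and J X^T J = X, one has -x - X = J (x - X)^T J. The two determinants of J
   multiply to det(-1) = 1 in size four. *)
have -> : map_mx (comp_poly (- 'X)) (char_poly_mx X) = Jp *m (char_poly_mx X)^T *m Jp.
  rewrite /char_poly_mx map_mxB map_scalar_mx /= comp_polyX linearB /= tr_scalar_mx.
  rewrite map_trmx mulmxBr mulmxBl JpX; congr (_ - _).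
    by rewrite scalar_mxC -mulmxA Jp2 mulmxN mulmx1 raddfN.
  by apply/matrixP=> i j; rewrite !mxE comp_polyC.
rewrite !det_mulmx det_tr mulrAC -det_mulmx Jp2 -scaleN1r detZ det1 mulr1 -signr_odd /=.
by rewrite expr0 mul1r.
Qed.

(** The quadratic formula, with [e] a square root of the discriminant. *)
Lemma monic_quad_factor (q : {poly F}) : 2%:R != 0 :> F ->
    (forall x : F, exists t, t ^+ 2 = x) -> q \is monic -> size q = 3%N ->
  exists r s : F, q = ('X - r%:P) * ('X - s%:P).
Proof.
move=> F2 sqF /monicP; rewrite /lead_coef => q1 sq3; rewrite sq3 /= in q1.
have [e e2] := sqF (q`_1 ^+ 2 - 4%:R * q`_0).
pose r := (- q`_1 + e) / 2%:R; pose s := (- q`_1 - e) / 2%:R; exists r, s.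
have c0 : q`_0 = r * s.
  rewrite [RHS](_ : _ = (q`_1 ^+ 2 - e ^+ 2) / 4%:R).
    by rewrite e2; field; rewrite (natrM _ 2 2) mulf_neq0.
  by rewrite /r /s; field; rewrite (natrM _ 2 2) mulf_neq0 // F2.
have c1 : q`_1 = - (r + s) by rewrite /r /s; field.
have -> : q = (q`_0)%:P + (q`_1)%:P * 'X + 'X^2.
  apply/polyP => -[|[|[|i]]]; rewrite !coefE /= ?mulr0 ?mulr1 ?addr0 ?add0r //.
  by rewrite nth_default // sq3.
by rewrite c0 c1 polyCN polyCD polyCM; ring.
Qed.

(** The even characteristic polynomial is a monic quadratic in x^2. It splits, and l, m are square
    roots of its two roots; Cayley-Hamilton concludes. *)
Lemma sp4_annihilator (X : 'M[F]_4) : 2%:R != 0 :> F ->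
    (forall x : F, exists t, t ^+ 2 = x) -> in_sp4 X ->
  exists l m : F, horner_mx X (('X^2 - l%:P ^+ 2) * ('X^2 - m%:P ^+ 2)) = 0.
Proof.
move=> F2 sqF Xsp; set p := char_poly X.
have sp : size p = 5%N by rewrite size_char_poly.
have pE : p = even_poly p \Po 'X^2.
  have := char_poly_sp4_even Xsp; rewrite -/p -(poly_even_odd p).
  rewrite comp_polyD comp_polyM -!comp_polyA comp_polyX rmorphXn /= comp_polyX sqrrN.
  (* Comparing p(-x) with p(x) leaves twice the odd part equal to zero. *)
  move/addrI/eqP; rewrite mulrN eq_sym -addr_eq0 -mulr2n -mulr_natl mulf_eq0.
  rewrite -polyC_natr polyC_eq0 (negPf F2) /= => /eqP odd0.
  by rewrite -{1}(poly_even_odd p) odd0 addr0.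
have sq : size (even_poly p) = 3%N by rewrite size_even_poly_eq sp.
have qm : even_poly p \is monic.
  have /monicP := char_poly_monic X; rewrite -/p /lead_coef sp /= => p4.
  by apply/monicP; rewrite /lead_coef sq /= coef_even_poly.
have [r [s qE]] := monic_quad_factor F2 sqF qm sq.
have [[l l2] [m m2]] := (sqF r, sqF s); exists l, m.
rewrite -!polyC_exp l2 m2 -[RHS](Cayley_Hamilton X) -/p pE qE.
by rewrite !comp_polyE.
Qed.

Lemma Sp4_conjugate_mixed (X : 'M[F]_4) : 2%:R != 0 :> F ->
    (forall x : F, exists t, t ^+ 2 = x) -> in_sp4 X ->
    ~ mx_semisimple X -> ~ mx_nilpotent X ->
  Sp4_conjugate <[X]> <[sp4_T 1 0 + X_alpha]> \/
  Sp4_conjugate <[X]> <[sp4_T 1 1 + X_beta]>.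
Proof.
move=> F2 sqF Xsp nss nnil; have [l [m]] := sp4_annihilator F2 sqF Xsp.
(* The annihilator is symmetric in l and m, so a nonzero one may be called l; if both vanish, X^4 =
   0. *)
wlog l0 : l m / l != 0 => [wl|].
  have [->|l0] := eqVneq l 0; last exact: wl.
  have [->|m0] := eqVneq m 0; last by rewrite mulrC; exact: wl.
  rewrite polyC0 expr0n subr0 -exprD rmorphXn /= horner_mx_X => X4.
  by case: nnil; exists 4%N.
have [->|m0] := eqVneq m 0.
  rewrite polyC0 [0 ^+ 2]expr0n subr0 => pX; left.
  exact: Sp4_conjugate_T10_poly pX nss nnil.
have [ml|ml] := eqVneq (m ^+ 2) (l ^+ 2) => pX.
  by right; apply: (Sp4_conjugate_T11_poly F2 Xsp l0) => //;
    rewrite -[RHS]pX -!polyC_exp ml.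
have neq2 (x : F) : x != 0 -> x != - x.
  by move=> x0; rewrite -addr_eq0 -mulr2n -mulr_natl mulf_neq0.
(* In the remaining case l, -l, m, -m are four distinct roots. *)
case: nss; apply: (@diagonalizable_roots _ [:: l; - l; m; - m]).
  move: ml; rewrite eqf_sqr negb_or => /andP[ml mNl].
  have Nlm : - l != m by rewrite eq_sym.
  rewrite /= !inE !negb_or !eqr_opp -[l == - m]eqr_oppLR Nlm [l == m]eq_sym ml.
  by rewrite !neq2.
rewrite unlock /= -[RHS]pX !polyCN; congr horner_mx; ring.
Qed.

(** * Membership of the listed lines in the class *)

Lemma bvec_sp4_J i : (0 < i <= 4)%N ->
  bvec i *m J = [:: bvec 3; bvec 4; - bvec 1; - bvec 2]`_i.-1.
Proof.
move=> i4; apply/rowP => j; rewrite -rowE mxE sp4_JE.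
case: i i4 => [|[|[|[|[|i]]]]] // _;
  rewrite inordK //= !mxE eqxx /= -(inj_eq val_inj) /= inordK //.
all: by move: j => [[|[|[|[|j]]]] //= ?]; rewrite ?subrr ?subr0 ?sub0r ?oppr0.
Qed.

Lemma bvec_mx_ext (A B : 'M[F]_4) :
  (forall i, (0 < i <= 4)%N -> bvec i *m A = bvec i *m B) -> A = B.
Proof.
move=> AB; apply/row_matrixP => i; rewrite !rowE.
by have := AB i.+1 (ltn_ord i); rewrite /bvec /= inord_val.
Qed.

Lemma in_sp4D (X Y : 'M[F]_4) : in_sp4 X -> in_sp4 Y -> in_sp4 (X + Y).
Proof. by rewrite /in_sp4 linearD /= mulmxDr mulmxDl => -> ->. Qed.

Lemma in_sp4Z (a : F) (X : 'M[F]_4) : in_sp4 X -> in_sp4 (a *: X).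
Proof. by rewrite /in_sp4 linearZ /= -scalemxAr -scalemxAl => ->. Qed.

Lemma tr_sp4_E i j : (sp4_E F i j)^T = sp4_E F j i.
Proof. exact: trmx_delta. Qed.

(** Identities between explicit matrices are checked on basis rows, where each named matrix acts by
    a rewriting rule. *)
Ltac bvec_simpl :=
  rewrite ?(mulmxDr, mulmxBr, mulmxA, mulmxN, bvec_sp4_J, bvec_sp4_T, bvec_sp4_E) //=
    ?(mulmxDr, mulmxBr, mulmxDl, mulmxBl, mulmxN, mulNmx, =^~ scalemxAl,
      bvec_sp4_J, bvec_sp4_T, bvec_sp4_E) //=
    ?(scale1r, scale0r, scaler0, mul0mx, oppr0, addr0, add0r, sub0r, subr0,
      opprK, scaleNr, mulNmx, scalerN) //=.

Lemma in_sp4_T (a b : F) : in_sp4 (sp4_T a b).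
Proof.
apply: bvec_mx_ext; case=> [|[|[|[|[|i]]]]] // _;
  rewrite tr_diag_mx -/(sp4_T a b); bvec_simpl.
Qed.

Lemma in_sp4_X_alpha : in_sp4 (X_alpha : 'M[F]_4).
Proof.
apply: bvec_mx_ext; case=> [|[|[|[|[|i]]]]] // _;
  rewrite tr_sp4_E; bvec_simpl.
Qed.

Lemma in_sp4_X_beta : in_sp4 (X_beta : 'M[F]_4).
Proof.
apply: bvec_mx_ext; case=> [|[|[|[|[|i]]]]] // _;
  rewrite linearB /= !tr_sp4_E; bvec_simpl.
Qed.

Lemma in_sp4_X_alpha_beta : in_sp4 (X_alpha_beta : 'M[F]_4).
Proof.
apply: bvec_mx_ext; case=> [|[|[|[|[|i]]]]] // _;
  rewrite linearD /= !tr_sp4_E; bvec_simpl.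
Qed.

Lemma in_sp4_X_alpha_2beta : in_sp4 (X_alpha_2beta : 'M[F]_4).
Proof.
apply: bvec_mx_ext; case=> [|[|[|[|[|i]]]]] // _;
  rewrite tr_sp4_E; bvec_simpl.
Qed.

(** The eigenvector u excludes nilpotency, and the Jordan chain starting at v excludes
    semisimplicity. Both obstructions survive nonzero scaling, so every generator is covered. *)
Lemma mixed_line (N : 'M[F]_4) (c d : F) (u v : 'rV[F]_4) :
    in_sp4 N -> c != 0 -> u != 0 -> u *m N = c *: u ->
    v *m (N - d%:M) != 0 -> v *m (N - d%:M) *m (N - d%:M) = 0 ->
  mixed_line_subalgebra <[N]>%VS.
Proof.
move=> Nsp c0 u0 uN vN vNN; have N0 : N != 0.
  apply: contraNneq u0 => N0; have /esym/eqP := uN.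
  by rewrite N0 mulmx0 scaler_eq0 (negPf c0).
split.
- split=> [X /vlineP[k ->]|X Y /vlineP[k ->] /vlineP[k' ->]]; first exact: in_sp4Z.
  by rewrite /lie_bracket -!scalemxAl -!scalemxAr !scalerA mulrC subrr mem0v.
- by rewrite dim_vline N0.
move=> X NX; have /vlineP[k Xk] : X \in <[N]>%VS by rewrite NX memv_line.
have k0 : k != 0.
  apply: contraNneq N0 => k0; have := dim_vline N.
  by rewrite NX Xk k0 scale0r dim_vline eqxx; case: (N == 0).
have XkB : X - (k * d)%:M = k *: (N - d%:M) by rewrite Xk scalerBr scale_scalar_mx.
split=> [Xss|[n]].
  have := @diagonalizable_ker2 _ X (k * d) v Xss.
  rewrite XkB -!scalemxAr -!scalemxAl vNN !scaler0 => /(_ erefl) /eqP.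
  by rewrite scaler_eq0 (negPf k0) (negPf vN).
have uX : u *m X ^+ n = (k * c) ^+ n *: u.
  elim: n => [|n IH]; first by rewrite !expr0 mulmx1 scale1r.
  rewrite exprSr -[_ * _]/(_ *m _) mulmxA IH -scalemxAl Xk.
  by rewrite -scalemxAr uN !scalerA -mulrA -exprSr.
move=> Xn; move: uX; rewrite Xn mulmx0 => /esym/eqP.
by rewrite scaler_eq0 expf_eq0 mulf_eq0 (negPf k0) (negPf c0) (negPf u0) !andbF.
Qed.

Lemma mixed_line_T10 : mixed_line_subalgebra <[sp4_T 1 0 + X_alpha : 'M[F]_4]>%VS.
Proof.
apply: (@mixed_line _ 1 0 (bvec 1) (bvec 2)); rewrite ?oner_eq0 ?bvec_neq0 //.
- exact: in_sp4D (in_sp4_T _ _) in_sp4_X_alpha.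
- by bvec_simpl.
- by rewrite raddf0 subr0; bvec_simpl; rewrite ?bvec_neq0.
- by rewrite raddf0 subr0; bvec_simpl.
Qed.

Lemma mixed_line_T11 : mixed_line_subalgebra <[sp4_T 1 1 + X_beta : 'M[F]_4]>%VS.
Proof.
have e1 : bvec 1 *m (sp4_T 1 1 + X_beta - 1%:M) = bvec 2.
  by rewrite mulmxBr mulmx1; bvec_simpl; rewrite addrAC subrr add0r.
apply: (@mixed_line _ 1 1 (bvec 2) (bvec 1)); rewrite ?e1 ?oner_eq0 ?bvec_neq0 //.
- exact: in_sp4D (in_sp4_T _ _) in_sp4_X_beta.
- by bvec_simpl.
- by rewrite mulmxBr mulmx1; bvec_simpl; rewrite subrr.
Qed.

(** * Irredundancy and the conjugate families *)

Lemma not_Sp4_conjugate_T10_T11 :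
  ~ Sp4_conjugate <[sp4_T 1 0 + X_alpha : 'M[F]_4]>%VS <[sp4_T 1 1 + X_beta]>%VS.
Proof.
set N1 := _ + X_alpha; set N2 := _ + X_beta.
(* The inverse comes from T^2 = 1, [X_beta] squared being 0, and T commuting with [X_beta], where T
   is [sp4_T 1 1]. *)
have N2V : N2 *m (sp4_T 1 1 - X_beta) = 1%:M.
  apply: bvec_mx_ext; case=> [|[|[|[|[|i]]]]] // _; rewrite mulmx1 /N2 mulmxA;
    by bvec_simpl; rewrite ?addrK.
case=> g [gU _]; rewrite limg_line sp4_AdE => gN1.
have /vlineP[k N2E] : N2 \in <[g *m N1 *m invmx g]>%VS by rewrite gN1 memv_line.
have e4N1 : bvec 4 *m N1 = 0 by rewrite /N1; bvec_simpl.
have : bvec 4 *m invmx g *m N2 = 0.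
  by rewrite N2E -scalemxAr !mulmxA mulmxKV // e4N1 mul0mx scaler0.
move/(congr1 (fun x => x *m (sp4_T 1 1 - X_beta) *m g)).
by rewrite -[_ *m N2 *m _]mulmxA N2V mulmx1 mulmxKV // !mul0mx; exact/eqP/bvec_neq0.
Qed.

Lemma Sp4_conjugate_Ta0 (a : F) : 2%:R != 0 :> F ->
    (forall x : F, exists t, t ^+ 2 = x) -> a != 0 ->
  Sp4_conjugate <[sp4_T a 0 + X_alpha]>%VS <[sp4_T 1 0 + X_alpha]>%VS.
Proof.
move=> F2 sqF a0.
apply: (Sp4_conjugate_T10 (u := bvec 1) (v := bvec 2) (w := bvec 3) F2 sqF _ a0).
- exact: in_sp4D (in_sp4_T _ _) in_sp4_X_alpha.
- by bvec_simpl.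
- by bvec_simpl.
- by bvec_simpl.
- by rewrite sform_bvec //= subr0 oner_eq0.
- by bvec_simpl; rewrite sform_bvec //= subr0 oner_eq0.
Qed.

(** The indices 1, 3 exchange roles with 2, 4: now [bvec 1] is sent to [bvec 3], and [bvec 2],
    [bvec 4] are the eigenvectors. *)
Lemma Sp4_conjugate_T0a (a : F) : 2%:R != 0 :> F ->
    (forall x : F, exists t, t ^+ 2 = x) -> a != 0 ->
  Sp4_conjugate <[sp4_T 0 a + X_alpha_2beta]>%VS <[sp4_T 1 0 + X_alpha]>%VS.
Proof.
move=> F2 sqF a0.
apply: (Sp4_conjugate_T10 (u := bvec 2) (v := bvec 1) (w := bvec 4) F2 sqF _ a0).
- exact: in_sp4D (in_sp4_T _ _) in_sp4_X_alpha_2beta.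
- by bvec_simpl.
- by bvec_simpl.
- by bvec_simpl.
- by rewrite sform_bvec //= subr0 oner_eq0.
- by bvec_simpl; rewrite sform_bvec //= subr0 oner_eq0.
Qed.

Lemma Sp4_conjugate_Taa (a : F) : 2%:R != 0 :> F -> a != 0 ->
  Sp4_conjugate <[sp4_T a a + X_beta]>%VS <[sp4_T 1 1 + X_beta]>%VS.
Proof.
move=> F2 a0; set N := _ + X_beta.
have e1 : bvec 1 *m (N - a%:M) = bvec 2.
  by rewrite mulmxBr mul_mx_scalar; bvec_simpl; rewrite addrAC subrr add0r.
have e4 : bvec 4 *m (N + a%:M) = - bvec 3.
  by rewrite mulmxDr mul_mx_scalar; bvec_simpl; rewrite addrAC addNr add0r.
apply: (Sp4_conjugate_T11 (u := bvec 1) (w := bvec 4) F2 _ a0); rewrite ?e1 ?e4.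
- exact: in_sp4D (in_sp4_T _ _) in_sp4_X_beta.
- by rewrite mulmxBr mul_mx_scalar; bvec_simpl; rewrite subrr.
- by rewrite mulNmx mulmxDr mul_mx_scalar; bvec_simpl; rewrite ?addNr ?subrr ?oppr0.
- by rewrite sform_bvec //= subr0 oner_eq0.
Qed.

(** The eigenvalue a lives on indices 1, 4 and -a on 2, 3, with Jordan chains from [bvec 1] to
    [bvec 4] and from [bvec 2] to [bvec 3]. *)
Lemma Sp4_conjugate_TaNa (a : F) : 2%:R != 0 :> F -> a != 0 ->
  Sp4_conjugate <[sp4_T a (- a) + X_alpha_beta]>%VS <[sp4_T 1 1 + X_beta]>%VS.
Proof.
move=> F2 a0; set N := _ + X_alpha_beta.
have e1 : bvec 1 *m (N - a%:M) = bvec 4.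
  by rewrite mulmxBr mul_mx_scalar; bvec_simpl; rewrite addrAC subrr add0r.
have e2 : bvec 2 *m (N + a%:M) = bvec 3.
  by rewrite mulmxDr mul_mx_scalar; bvec_simpl; rewrite addrAC addNr add0r.
apply: (Sp4_conjugate_T11 (u := bvec 1) (w := bvec 2) F2 _ a0); rewrite ?e1 ?e2.
- exact: in_sp4D (in_sp4_T _ _) in_sp4_X_alpha_beta.
- by rewrite mulmxBr mul_mx_scalar; bvec_simpl; rewrite subrr.
- by rewrite mulmxDr mul_mx_scalar; bvec_simpl; rewrite addNr.
- by rewrite sform_bvec //= sub0r oppr_eq0 oner_eq0.
Qed.

End Sp4Lines.

Theorem theorem4p3 (R : realType) :
  let L1 : {vspace 'M[R[i]]_4} := <[sp4_T 1 0 + X_alpha]>%VS in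
  let L2 : {vspace 'M[R[i]]_4} := <[sp4_T 1 1 + X_beta]>%VS in
  [/\ (* L1, L2 belong to the class *)
      mixed_line_subalgebra L1 /\ mixed_line_subalgebra L2,
      (* completeness *)
      forall L : {vspace 'M[R[i]]_4},
        mixed_line_subalgebra L -> Sp4_conjugate L L1 \/ Sp4_conjugate L L2,
      (* irredundancy *)
      ~ Sp4_conjugate L1 L2,
      forall a : R[i], a != 0 ->
        Sp4_conjugate <[sp4_T a 0 + X_alpha]>%VS L1 /\
        Sp4_conjugate <[sp4_T 0 a + X_alpha_2beta]>%VS L1
    & forall a : R[i], a != 0 ->
        Sp4_conjugate <[sp4_T a a + X_beta]>%VS L2 /\
        Sp4_conjugate <[sp4_T a (- a) + X_alpha_beta]>%VS L2].
Proof.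
move=> L1 L2.
have F2 : 2%:R != 0 :> R[i] by rewrite pnatr_eq0.
have sqF (x : R[i]) : exists t : R[i], t ^+ 2 = x by exists (sqrtC x); rewrite sqrtCK.
split.
- by split; [exact: mixed_line_T10 | exact: mixed_line_T11].
- move=> L [[Lsp _] dimL Lmix].
  (* A one-dimensional space is spanned by any nonzero element, here the chosen [vpick L]. *)
  have LE : L = <[vpick L]>%VS.
    apply/esym/eqP; rewrite eqEdim -memvE memv_pick dimL dim_vline vpick0.
    by rewrite -dimv_eq0 dimL.
  have [nss nnil] := Lmix _ LE.
  by rewrite LE; exact: Sp4_conjugate_mixed F2 sqF (Lsp _ (memv_pick L)) nss nnil.
- exact: not_Sp4_conjugate_T10_T11.
- by move=> a a0; split; [exact: Sp4_conjugate_Ta0 | exact: Sp4_conjugate_T0a].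
- by move=> a a0; split; [exact: Sp4_conjugate_Taa | exact: Sp4_conjugate_TaNa].
Qed.
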